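(* Let $(\alpha_1,\alpha_2,\alpha_3)\in\mathbb R^3$ with $\alpha_1^2+\alpha_2^2+\alpha_3^2=1$, $\beta\in\mathbb R$, $t\in\mathbb R$, and put $$m_2=\tfrac t2,\quad n_2=1\quad\text{if }\beta^2=1-\alpha_2^2;$$ $$m_2=\frac{\sinh\frac{t\sqrt{1-\alpha_2^2-\beta^2}}{2}}{\sqrt{1-\alpha_2^2-\beta^2}},\quad n_2=\cosh\frac{t\sqrt{1-\alpha_2^2-\beta^2}}{2}\quad\text{if }\beta^2<1-\alpha_2^2;$$ $$m_2=\frac{\sin\frac{t\sqrt{\beta^2+\alpha_2^2-1}}{2}}{\sqrt{\beta^2+\alpha_2^2-1}},\quad n_2=\cos\frac{t\sqrt{\beta^2+\alpha_2^2-1}}{2}\quad\text{if }\beta^2>1-\alpha_2^2.$$ If $\alpha_2\ne\pm1$, then the geodesic $\tilde\gamma_2(t)=\tilde\gamma_2(\alpha_1,\alpha_2,\alpha_3,\beta;t)=(A,B,v)(t)$, $t\in\mathbb R$, of $(SU(1,1)\times\mathbb R,d_2)$ is given by $$A=\left(n_2\cos\tfrac{\beta t}{2}+\beta m_2\sin\tfrac{\beta t}{2}\right)+\left(n_2\sin\tfrac{\beta t}{2}-\beta m_2\cos\tfrac{\beta t}{2}\right)i,$$ $$B=m_2\sqrt{1-\alpha_2^2}\left[\cos\left(\tfrac{\beta t}{2}+\varphi_0\right)-\sin\left(\tfrac{\beta t}{2}+\varphi_0\right)i\right],\qquad v=\alpha_2t,$$ where $\cos\varphi_0=\frac{\alpha_1}{\sqrt{1-\alpha_2^2}}$,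 $\sin\varphi_0=-\frac{\alpha_3}{\sqrt{1-\alpha_2^2}}$. If $\alpha_2=\pm1$, then this geodesic is $\tilde\gamma_2(t)=(e,\alpha_2t)$, $t\in\mathbb R$, where $e$ is the identity $2\times2$ matrix (i.e. $A=1$, $B=0$, $v=\alpha_2t$).
   Context: $SU(1,1)\times\mathbb R$ is the group of matrices $(A,B,v):=\begin{pmatrix}A&B&0\\ \overline B&\overline A&0\\0&0&e^v\end{pmatrix}$ with $A,B\in\mathbb C$, $|A|^2-|B|^2=1$, $v\in\mathbb R$. Its Lie algebra has basis $E_1=\frac12(e_{12}+e_{21})$, $E_2=\frac i2(e_{12}-e_{21})$, $E_3=\frac i2(e_{11}-e_{22})$, $E_4=e_{33}$, where $e_{ij}$ (double indices) are the $3\times3$ matrix units. Put $e_1=E_1$, $e_2=E_4$, $e_3=E_2$, $e_4=-E_3$. $d_2$ is the left-invariant sub-Riemannian metric defined by the left-invariant distribution with value $\mathrm{span}(e_1,e_2,e_3)$ at the unit $\mathrm{Id}$ and the inner product with orthonormal basis $e_1,e_2,e_3$. The arclength-parametrized geodesics of $d_2$ starting at $\mathrm{Id}$ are the curves $\tilde\gamma_2(\alpha_1,\alpha_2,\alpha_3,\beta;t)=\exp(t(\alpha_1e_1+\alpha_2e_2+\alpha_3e_3+\beta e_4))\exp(-t\beta e_4)$ with $\alpha_1^2+\alpha_2^2+\alpha_3^2=1$, $\beta\in\mathbb R$. *)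

(* Defs.v *)
From mathcomp Require Import all_boot all_order all_algebra.
From mathcomp Require Import complex.
From mathcomp Require Import all_classical all_reals all_analysis.

Set Implicit Arguments.
Unset Strict Implicit.
Unset Printing Implicit Defensive.

Import Order.TTheory GRing.Theory Num.Theory.
Import numFieldNormedType.Exports.

Local Open Scope classical_set_scope.
Local Open Scope ring_scope.
Local Open Scope complex_scope.

Definition sinh (R : realType) (x : R) : R := (expR x - expR (- x)) / 2.
Definition cosh (R : realType) (x : R) : R := (expR x + expR (- x)) / 2.

Definition expmx (K : numFieldType) (n : nat) (X : 'M[K]_n.+1) : 'M[K]_n.+1 :=
  limn (series (fun k : nat => (k`!%:R)^-1 *: X ^+ k)).

(* Indices are zero-based: the matrix unit e_ij is delta_mx (i-1) (j-1). *)
Definition su11R_mx (R : realType) (A B : R[i]) (v : R) : 'M[R[i]]_3 :=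
  A *: delta_mx 0 0 + B *: delta_mx 0 1 +
  B^* *: delta_mx 1 0 + A^* *: delta_mx 1 1 +
  (expR v)%:C *: delta_mx 2 2.

(* M is the element (A, B, v) of the group SU(1,1) x R. *)
Definition is_su11R (R : realType) (M : 'M[R[i]]_3) (A B : R[i]) (v : R) :=
  `|A| ^+ 2 - `|B| ^+ 2 = 1 /\ M = su11R_mx A B v.

Section LieAlgebra.
Variable R : realType.

Definition E1 : 'M[R[i]]_3 := 2^-1 *: (delta_mx 0 1 + delta_mx 1 0).
Definition E2 : 'M[R[i]]_3 := ('i / 2) *: (delta_mx 0 1 - delta_mx 1 0).
Definition E3 : 'M[R[i]]_3 := ('i / 2) *: (delta_mx 0 0 - delta_mx 1 1).
Definition E4 : 'M[R[i]]_3 := delta_mx 2 2.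

(* The metric d_2 is given by the left-invariant distribution spanned at the
   unit by the orthonormal vectors e1, e2, e3. *)
Definition e1 := E1.
Definition e2 := E4.
Definition e3 := E2.
Definition e4 := - E3.

(* The arclength-parametrized geodesic of d_2 starting at the unit, with
   parameters a1^2 + a2^2 + a3^2 = 1 and b. *)
Definition gamma2 (a1 a2 a3 b t : R) : 'M[R[i]]_3 :=
  expmx (t%:C *: (a1%:C *: e1 + a2%:C *: e2 + a3%:C *: e3 + b%:C *: e4)) *m
  expmx ((- (t * b))%:C *: e4).

Definition m2 (a2 b t : R) : R :=
  if b ^+ 2 == 1 - a2 ^+ 2 then t / 2
  else if b ^+ 2 < 1 - a2 ^+ 2 then
    sinh (t * Num.sqrt (1 - a2 ^+ 2 - b ^+ 2) / 2) /
    Num.sqrt (1 - a2 ^+ 2 - b ^+ 2)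
  else
    sin (t * Num.sqrt (b ^+ 2 + a2 ^+ 2 - 1) / 2) /
    Num.sqrt (b ^+ 2 + a2 ^+ 2 - 1).

Definition n2 (a2 b t : R) : R :=
  if b ^+ 2 == 1 - a2 ^+ 2 then 1
  else if b ^+ 2 < 1 - a2 ^+ 2 then
    cosh (t * Num.sqrt (1 - a2 ^+ 2 - b ^+ 2) / 2)
  else
    cos (t * Num.sqrt (b ^+ 2 + a2 ^+ 2 - 1) / 2).

End LieAlgebra.

(* Main.v *)
Require Import Defs.
From mathcomp Require Import all_boot all_order all_algebra.
From mathcomp Require Import complex ring.
From mathcomp Require Import all_classical all_reals all_analysis.

Import Order.TTheory GRing.Theory Num.Theory.
Import numFieldNormedType.Exports.

Local Open Scope ring_scope.

(** The velocity of the geodesic, scaled by [t], splits as [t X + a2 t E], where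
    [E] is the idempotent spanning the line factor and [X] lies in su(1,1). The
    two summands annihilate each other, and by Cayley-Hamilton for trace-free
    2 x 2 matrices [X] squares to [(1 - a2^2 - b^2) / 4] times the complementary
    idempotent [1 - E]. Hence powers of the velocity stay in the span of
    [1 - E], [X] and [E], and its exponential series splits into three scalar
    series (lemma [expmx_square_scalar]). According to the sign of
    [1 - a2^2 - b^2], a rescaling of [X] squares to [1 - E], to [-(1 - E)] or
    to [0], so that the first two series are those of (cosh, sinh), of
    (cos, sin), or finite; in each case the exponential is
    [n (1 - E) + 2 m X + e^(a2 t) E] (lemma [expmx_velocity]). The second
    factor of the geodesic is a rotation, given by the trigonometric case, and
    the formulas for [A] and [B] come from multiplying the two factors.

    The scalar series are real whereas the matrices are complex. All of the
    matrix algebra is therefore done over an arbitrary algebraically closed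
    numeric field [K] receiving a sequentially continuous ring morphism [f]
    from the reals with self-conjugate values, of which [R[i]] with the
    embedding [x |-> x%:C] is an instance. *)

(** * Exponential of a matrix with scalar square off an idempotent *)

Section ExpSquareScalar.
Local Open Scope classical_set_scope.

Lemma expmx_eq (K : numFieldType) (n : nat) (X L : 'M[K]_n.+1) :
  series (fun k : nat => (k`!%:R)^-1 *: X ^+ k) @ \oo --> L -> expmx X = L.
Proof. by apply: cvg_lim; exact: norm_hausdorff. Qed.

(** Since [Z] squares to a multiple of [1 - Q], for which it is neutral, even
    and odd powers of [w *: Z] are scalar multiples of [1 - Q] and of [Z]; the
    powers of [c *: Q] evolve independently because [Q] and [Z] annihilate
    each other. The exponent [0] fits in the pattern since [1 = (1 - Q) + Q]. *)
Lemma expmx_square_scalar (K : numFieldType) (n : nat) (Q Z : 'M[K]_n.+1)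
    (w eps c C S E : K) :
  Q * Q = Q -> Q * Z = 0 -> Z * Q = 0 -> Z * Z = eps *: (1 - Q) ->
  series (fun k => (~~ odd k)%:R * eps ^+ k./2 * w ^+ k / k`!%:R) @ \oo --> C ->
  series (fun k => (odd k)%:R * eps ^+ k./2 * w ^+ k / k`!%:R) @ \oo --> S ->
  series (fun k => c ^+ k / k`!%:R) @ \oo --> E ->
  expmx (w *: Z + c *: Q) = C *: (1 - Q) + S *: Z + E *: Q.
Proof.
move=> QQ QZ ZQ ZZ cC cS cE; apply: expmx_eq.
pose p k := (~~ odd k)%:R * eps ^+ k./2 * w ^+ k.
pose q k := (odd k)%:R * eps ^+ k./2 * w ^+ k.
have p0 : p 0%N = 1 by rewrite /p /= !expr0 !mulr1.
have q0 : q 0%N = 0 by rewrite /q /= !mul0r.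
have pS k : p k.+1 = w * q k * eps.
  rewrite /p /q /= negbK uphalf_half exprS.
  case: (odd k); last by rewrite !mul0r mulr0 mul0r.
  by rewrite exprS; ring.
have qS k : q k.+1 = w * p k.
  rewrite /p /q /= uphalf_half exprS.
  case: (odd k); first by rewrite !mul0r mulr0.
  by rewrite add0n; ring.
rewrite -/p in cC; rewrite -/q in cS.
have powE k : (w *: Z + c *: Q) ^+ k = p k *: (1 - Q) + q k *: Z + c ^+ k *: Q.
  have ZP : Z * (1 - Q) = Z by rewrite mulrBr mulr1 ZQ subr0.
  have QP : Q * (1 - Q) = 0 by rewrite mulrBr mulr1 QQ subrr.
  elim: k => [|k IH].
    by rewrite p0 q0 !expr0 !scale1r scale0r addr0 addrNK.
  rewrite exprS IH !mulrDl !mulrDr -!scalerAl -!scalerAr ZP QP ZZ QZ ZQ QQ.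
  rewrite !scaler0 !addr0 !add0r !scalerA -exprS pS qS.
  by rewrite [X in X + _]addrC.
have -> : series (fun k : nat => k`!%:R^-1 *: (w *: Z + c *: Q) ^+ k) =
   (fun n => series (fun k => p k / k`!%:R) n *: (1 - Q) +
     series (fun k => q k / k`!%:R) n *: Z +
     series (fun k => c ^+ k / k`!%:R) n *: Q).
  apply/funext => m; rewrite !seriesEnat /= !scaler_suml -!big_split /=.
  apply: eq_bigr => k _; rewrite powE !scalerDr !scalerA.
  by rewrite [_^-1 * p k]mulrC [_^-1 * q k]mulrC [_^-1 * (c ^+ k)]mulrC.
by apply: cvgD; [apply: cvgD|]; apply: cvgZr_tmp.
Qed.

Lemma eq_cvg_seq (T : topologicalType) (u v : nat -> T) (l : T) :
  u =1 v -> u @ \oo --> l -> v @ \oo --> l.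
Proof. by move=> /funext ->. Qed.

Section RealCoefficients.
Variables (R : realType) (K : numFieldType) (f : {rmorphism R -> K}).
Hypothesis f_cvg : forall (u : nat -> R) (l : R),
  u @ \oo --> l -> (fun k => f (u k)) @ \oo --> f l.
Variable n : nat.
Implicit Types (Q Z : 'M[K]_n.+1) (w c : R).

Lemma cvg_series_rmorph (u : nat -> R) (v : nat -> K) (l : R) :
  (forall k, f (u k) = v k) -> series u @ \oo --> l -> series v @ \oo --> f l.
Proof.
move=> uv /f_cvg; apply: eq_cvg_seq => m.
by rewrite !seriesEnat /= rmorph_sum; apply: eq_bigr => k _; exact: uv.
Qed.

Lemma expmx_square_real Q Z (w eps c C S : R) :
  Q * Q = Q -> Q * Z = 0 -> Z * Q = 0 -> Z * Z = f eps *: (1 - Q) ->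
  series (fun k => (~~ odd k)%:R * eps ^+ k./2 * w ^+ k / k`!%:R) @ \oo --> C ->
  series (fun k => (odd k)%:R * eps ^+ k./2 * w ^+ k / k`!%:R) @ \oo --> S ->
  expmx (f w *: Z + f c *: Q) = f C *: (1 - Q) + f S *: Z + f (expR c) *: Q.
Proof.
move=> QQ QZ ZQ ZZ cC cS.
have cE : series (exp_coeff c) @ \oo --> expR c.
  exact: is_cvg_series_exp_coeff.
apply: (@expmx_square_scalar _ _ _ _ _ (f eps)) => //.
- apply: cvg_series_rmorph cC => k.
  by rewrite !rmorphM fmorphV !rmorphXn !rmorph_nat.
- apply: cvg_series_rmorph cS => k.
  by rewrite !rmorphM fmorphV !rmorphXn !rmorph_nat.
- apply: cvg_series_rmorph cE => k.
  by rewrite /exp_coeff /= !rmorphM fmorphV !rmorphXn !rmorph_nat.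
Qed.

Lemma expmx_hyperbolic Q Z w c :
  Q * Q = Q -> Q * Z = 0 -> Z * Q = 0 -> Z * Z = 1 - Q ->
  expmx (f w *: Z + f c *: Q) =
  f (cosh w) *: (1 - Q) + f (sinh w) *: Z + f (expR c) *: Q.
Proof.
move=> QQ QZ ZQ ZZ.
have cE (x : R) : series (exp_coeff x) @ \oo --> expR x.
  exact: is_cvg_series_exp_coeff.
have cC : (fun m => (series (exp_coeff w) m + series (exp_coeff (- w)) m) / 2)
    @ \oo --> cosh w by apply: cvgMr_tmp; exact: cvgD.
have cS : (fun m => (series (exp_coeff w) m - series (exp_coeff (- w)) m) / 2)
    @ \oo --> sinh w by apply: cvgMr_tmp; exact: cvgB.
have k0 k : k`!%:R != 0 :> R by rewrite pnatr_eq0 -lt0n fact_gt0.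
apply: (@expmx_square_real _ _ _ 1) => //; first by rewrite rmorph1 scale1r.
- apply: eq_cvg_seq cC => m.
  rewrite /= !seriesEnat /= -big_split mulr_suml /=; apply: eq_bigr => k _.
  rewrite /exp_coeff /= expr1n exprNn -signr_odd.
  by case: (odd k) => /=; field.
- apply: eq_cvg_seq cS => m.
  rewrite /= !seriesEnat /= -sumrB mulr_suml /=; apply: eq_bigr => k _.
  rewrite /exp_coeff /= expr1n exprNn -signr_odd.
  by case: (odd k) => /=; field.
Qed.

Lemma expmx_elliptic Q Z w c :
  Q * Q = Q -> Q * Z = 0 -> Z * Q = 0 -> Z * Z = - (1 - Q) ->
  expmx (f w *: Z + f c *: Q) =
  f (cos w) *: (1 - Q) + f (sin w) *: Z + f (expR c) *: Q.
Proof.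
move=> QQ QZ ZQ ZZ.
apply: (@expmx_square_real _ _ _ (-1)) => //.
- by rewrite rmorphN1 scaleN1r.
- by have := @is_cvg_series_cos_coeff R w; rewrite cos.unlock.
- have := @is_cvg_series_sin_coeff R w; rewrite sin.unlock.
  (* The coefficients of the sine carry the exponent [k.-1./2] instead of
     [k./2]: these agree for odd [k], and the other coefficients vanish. *)
  apply: eq_cvg_seq => m; rewrite !seriesEnat; apply: eq_bigr => k _ /=.
  rewrite /sin_coeff /=; case: k => // k /=; rewrite uphalf_half.
  by case: (odd k); rewrite ?mul0r// add0n.
Qed.

Lemma expmx_parabolic Q Z w c :
  Q * Q = Q -> Q * Z = 0 -> Z * Q = 0 -> Z * Z = 0 ->
  expmx (f w *: Z + f c *: Q) = (1 - Q) + f w *: Z + f (expR c) *: Q.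
Proof.
move=> QQ QZ ZQ ZZ.
have -> : 1 - Q = f 1 *: (1 - Q) by rewrite rmorph1 scale1r.
(* With [eps = 0], all the terms of index at least 2 vanish. *)
apply: (@expmx_square_real _ _ _ 0) => //.
- by rewrite rmorph0 scale0r.
- rewrite -(cvg_shiftn 2); apply: eq_cvg_seq (cvg_cst (1 : R)) => m.
  rewrite seriesEnat /= addn2 !big_nat_recl// big1 => [|k _].
    by rewrite /= !expr0 expr1 !mul0r !mul1r !addr0 fact0 invr1.
  by rewrite -addn2 halfD andbF add0n addn1 exprS mul0r mulr0 !mul0r.
- rewrite -(cvg_shiftn 2); apply: eq_cvg_seq (cvg_cst (w : R)) => m.
  rewrite seriesEnat /= addn2 !big_nat_recl// big1 => [|k _].
    by rewrite /= !expr0 expr1 !mul0r !mul1r add0r addr0 invr1 mulr1.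
  by rewrite -addn2 halfD andbF add0n addn1 exprS mul0r mulr0 !mul0r.
Qed.

End RealCoefficients.
End ExpSquareScalar.

(** * Block matrices and the Lie algebra of SU(1,1) x R *)

Section LieAlgebraBlocks.
Variable K : numClosedFieldType.
Implicit Types a b m n p q r s u x : K.

Definition block21 p q r s u : 'M[K]_3 :=
  p *: delta_mx 0 0 + q *: delta_mx 0 1 + r *: delta_mx 1 0
  + s *: delta_mx 1 1 + u *: delta_mx 2 2.

Lemma block21M p q r s u p' q' r' s' u' :
  block21 p q r s u * block21 p' q' r' s' u' =
  block21 (p * p' + q * r') (p * q' + q * s')
          (r * p' + s * r') (r * q' + s * s') (u * u').
Proof.
apply/matrixP => i j; rewrite !mxE !big_ord_recl big_ord0 !mxE.
by case: i j => [[|[|[|//]]] ?] [[|[|[|//]]] ?] /=; ring.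
Qed.

Lemma block21Z x p q r s u :
  x *: block21 p q r s u = block21 (x * p) (x * q) (x * r) (x * s) (x * u).
Proof. by rewrite /block21 !scalerDr !scalerA. Qed.

Lemma block21_0 : block21 0 0 0 0 0 = 0.
Proof. by rewrite /block21 !scale0r !addr0. Qed.

Definition line : 'M[K]_3 := delta_mx 2 2.

(** The element [a1 e1 + a3 e3 + b e4] of su(1,1), with the basis elements
    unfolded so that they make sense over [K]. *)
Definition su11 a1 a3 b : 'M[K]_3 :=
  a1 *: (2^-1 *: (delta_mx 0 1 + delta_mx 1 0))
  + a3 *: (('i / 2) *: (delta_mx 0 1 - delta_mx 1 0))
  + b *: - (('i / 2) *: (delta_mx 0 0 - delta_mx 1 1)).

Lemma line_block21 : line = block21 0 0 0 0 1.
Proof. by rewrite /block21 !scale0r !add0r scale1r. Qed.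

Lemma one_sub_line : 1 - line = block21 1 0 0 1 0.
Proof.
apply/matrixP => i j; rewrite !mxE.
by case: i j => [[|[|[|//]]] ?] [[|[|[|//]]] ?] /=; ring.
Qed.

Lemma su11_block21 a1 a3 b :
  su11 a1 a3 b = block21 (- ('i * b / 2)) ((a1 + 'i * a3) / 2)
                         ((a1 - 'i * a3) / 2) ('i * b / 2) 0.
Proof. by apply/matrixP => i j; rewrite !mxE; ring. Qed.

Lemma line_idem : line * line = line.
Proof. by rewrite line_block21 block21M; f_equal; ring. Qed.

Lemma line_su11 a1 a3 b : line * su11 a1 a3 b = 0.
Proof.
by rewrite line_block21 su11_block21 block21M -block21_0; f_equal; ring.
Qed.

Lemma su11_line a1 a3 b : su11 a1 a3 b * line = 0.
Proof.
by rewrite line_block21 su11_block21 block21M -block21_0; f_equal; ring.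
Qed.

(** The Cayley-Hamilton identity for a trace-free 2 x 2 block. *)
Lemma su11_square a1 a3 b :
  su11 a1 a3 b * su11 a1 a3 b =
  ((a1 ^+ 2 + a3 ^+ 2 - b ^+ 2) / 4) *: (1 - line).
Proof.
have i2 := sqrCi K.
rewrite one_sub_line su11_block21 block21M block21Z.
by f_equal; field: i2.
Qed.

Lemma exp_su11_block21 n m u a1 a3 b :
  n *: (1 - line) + (2 * m) *: su11 a1 a3 b + u *: line =
  block21 (n - 'i * b * m) (m * (a1 + 'i * a3)) (m * (a1 - 'i * a3))
          (n + 'i * b * m) u.
Proof.
rewrite one_sub_line su11_block21.
by apply/matrixP => i j; rewrite !mxE; field.
Qed.

Lemma velocity_split a1 a2 a3 b x :
  x *: (a1 *: (2^-1 *: (delta_mx 0 1 + delta_mx 1 0)) + a2 *: line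
        + a3 *: (('i / 2) *: (delta_mx 0 1 - delta_mx 1 0))
        + b *: - (('i / 2) *: (delta_mx 0 0 - delta_mx 1 1)))
  = x *: su11 a1 a3 b + (a2 * x) *: line.
Proof. by apply/matrixP => i j; rewrite !mxE; ring. Qed.

Lemma su11_axis b :
  b *: - (('i / 2) *: (delta_mx 0 0 - delta_mx 1 1)) = su11 0 0 b.
Proof. by rewrite /su11 !scale0r !add0r. Qed.

Lemma su11_axisZ x b : x *: su11 0 0 b = su11 0 0 (x * b).
Proof. by rewrite /su11 !scale0r !add0r scalerA. Qed.

End LieAlgebraBlocks.
Arguments block21 {K}.
Arguments su11 {K}.

(** * The functions m and n *)

(** This is [det = 1] for the exponential of the su(1,1) part: the identity
    between cosh and sinh, or between cos and sin. *)
Lemma m2_n2_norm (R : realType) (a2 b t : R) :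
  n2 a2 b t ^+ 2 + (b ^+ 2 + a2 ^+ 2 - 1) * m2 a2 b t ^+ 2 = 1.
Proof.
rewrite /m2 /n2.
have [b2|b2|b2] := ltgtP (b ^+ 2) (1 - a2 ^+ 2).
- set r := Num.sqrt _.
  have r0 : r != 0 by rewrite sqrtr_eq0 -ltNge subr_gt0.
  have r2 : r ^+ 2 = 1 - a2 ^+ 2 - b ^+ 2.
    by rewrite sqr_sqrtr// ltW// subr_gt0.
  have -> : b ^+ 2 + a2 ^+ 2 - 1 = - r ^+ 2 by rewrite r2; ring.
  have e1 : expR (t * r / 2) * expR (- (t * r / 2)) = 1.
    by rewrite -expRD subrr expR0.
  by rewrite /sinh /cosh -[RHS]e1; field.
- set r := Num.sqrt _.
  have d0 : 0 < b ^+ 2 + a2 ^+ 2 - 1.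
    by move: b2; rewrite -subr_gt0 opprB addrA.
  have r0 : r != 0 by rewrite sqrtr_eq0 -ltNge.
  have r2 : r ^+ 2 = b ^+ 2 + a2 ^+ 2 - 1 by rewrite sqr_sqrtr// ltW.
  by rewrite -r2 -[RHS](cos2Dsin2 (t * r / 2)); field.
- have -> : b ^+ 2 + a2 ^+ 2 - 1 = 0 by rewrite b2; ring.
  by rewrite mul0r addr0 expr1n.
Qed.

(** * The geodesics *)

Section Geodesics.
Local Open Scope classical_set_scope.
Variables (R : realType) (K : numClosedFieldType) (f : {rmorphism R -> K}).
Hypothesis f_cvg : forall (u : nat -> R) (l : R),
  u @ \oo --> l -> (fun k => f (u k)) @ \oo --> f l.
Hypothesis f_conj : forall x, (f x)^* = f x.
Implicit Types a b c m n r s t : R.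

Let E : 'M[K]_3 := line K.

(** Let [r] be the square root of the absolute value of [1 - a2^2 - b^2]. If
    [r] is nonzero, then after division by [r / 2] the su(1,1) part squares to plus or minus the
    complementary idempotent; the division is what puts [r] into the
    denominator of [m2], and the half explains the factor [t / 2]. *)
Lemma expmx_velocity a1 a2 a3 b t : a1 ^+ 2 + a2 ^+ 2 + a3 ^+ 2 = 1 ->
  let X := su11 (f a1) (f a3) (f b) in
  expmx (f t *: X + f (a2 * t) *: E) =
  f (n2 a2 b t) *: (1 - E) + (2 * f (m2 a2 b t)) *: X
  + f (expR (a2 * t)) *: E.
Proof.
move=> ha X.
have EE : E * E = E by exact: line_idem.
have EX : E * X = 0 by exact: line_su11.
have XE : X * E = 0 by exact: su11_line.
have XX : X * X = f ((1 - a2 ^+ 2 - b ^+ 2) / 4) *: (1 - E).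
  have -> : 1 - a2 ^+ 2 - b ^+ 2 = a1 ^+ 2 + a3 ^+ 2 - b ^+ 2.
    by rewrite -ha; ring.
  by rewrite /X su11_square; congr (_ *: _); field.
have rescale r : r != 0 -> f t *: X = f (t * r / 2) *: (f (2 / r) *: X).
  move=> r0; rewrite scalerA -rmorphM; congr (f _ *: _); by field.
rewrite /m2 /n2; have [b2|b2|b2] := ltgtP (b ^+ 2) (1 - a2 ^+ 2).
- set r := Num.sqrt _.
  have r0 : r != 0 by rewrite sqrtr_eq0 -ltNge subr_gt0.
  have r2 : r ^+ 2 = 1 - a2 ^+ 2 - b ^+ 2.
    by rewrite sqr_sqrtr// ltW// subr_gt0.
  rewrite (rescale _ r0) (expmx_hyperbolic _ _ _ f_cvg) //.
  + rewrite scalerA; congr (_ + _ *: _ + _).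
    by rewrite !rmorphM rmorph_nat mulrCA.
  + by rewrite -scalerAr EX scaler0.
  + by rewrite -scalerAl XE scaler0.
  + rewrite -scalerAl -scalerAr XX !scalerA -!rmorphM -r2.
    by rewrite [X in f X](_ : _ = 1) ?rmorph1 ?scale1r//; field.
- set r := Num.sqrt _.
  have d0 : 0 < b ^+ 2 + a2 ^+ 2 - 1.
    by move: b2; rewrite -subr_gt0 opprB addrA.
  have r0 : r != 0 by rewrite sqrtr_eq0 -ltNge.
  have r2 : r ^+ 2 = b ^+ 2 + a2 ^+ 2 - 1 by rewrite sqr_sqrtr// ltW.
  rewrite (rescale _ r0) (expmx_elliptic _ _ _ f_cvg) //.
  + rewrite scalerA; congr (_ + _ *: _ + _).
    by rewrite !rmorphM rmorph_nat mulrCA.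
  + by rewrite -scalerAr EX scaler0.
  + by rewrite -scalerAl XE scaler0.
  + rewrite -scalerAl -scalerAr XX !scalerA -!rmorphM.
    have -> : 1 - a2 ^+ 2 - b ^+ 2 = - r ^+ 2 by rewrite r2; ring.
    by rewrite [X in f X](_ : _ = -1) ?rmorphN1 ?scaleN1r//; field.
- rewrite (expmx_parabolic _ _ _ f_cvg) //.
    rewrite rmorph1 scale1r; congr (_ + _ *: _ + _).
    by rewrite rmorphM fmorphV rmorph_nat mulrC divfK ?pnatr_eq0.
  by rewrite XX b2 subrr mul0r rmorph0 scale0r.
Qed.

(** The element [e4] is half of a complex structure on the 2 x 2 block, whence
    the half-angles. *)
Lemma expmx_rotation s c :
  expmx (su11 0 0 (f s) + f c *: E) =
  block21 (f (cos (s / 2)) - 'i * f (sin (s / 2))) 0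
            0 (f (cos (s / 2)) + 'i * f (sin (s / 2))) (f (expR c)).
Proof.
have -> : su11 0 0 (f s) = f (s / 2) *: su11 0 0 2.
  by rewrite su11_axisZ; congr (su11 0 0 _); field.
rewrite (expmx_elliptic _ _ _ f_cvg).
- have -> : f (sin (s / 2)) = 2 * (f (sin (s / 2)) / 2) by field.
  by rewrite exp_su11_block21; f_equal; field.
- exact: line_idem.
- exact: line_su11.
- exact: su11_line.
- rewrite su11_square -[RHS]scaleN1r; congr (_ *: _).
  by rewrite expr0n /= addr0 sub0r; field.
Qed.

Lemma conj_rect x y : (f x + 'i * f y)^* = f x - 'i * f y.
Proof. by rewrite rmorphD rmorphM /= conjCi !f_conj mulNr. Qed.

(** The curve [gamma2] transported to [K]; for [K = R[i]] the two unfold to the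
    same expression. *)
Definition geodesic a1 a2 a3 b t : 'M[K]_3 :=
  expmx (f t *: (f a1 *: (2^-1 *: (delta_mx 0 1 + delta_mx 1 0))
                 + f a2 *: delta_mx 2 2
                 + f a3 *: (('i / 2) *: (delta_mx 0 1 - delta_mx 1 0))
                 + f b *: - (('i / 2) *: (delta_mx 0 0 - delta_mx 1 1))))
  *m expmx (f (- (t * b)) *: - (('i / 2) *: (delta_mx 0 0 - delta_mx 1 1))).

Lemma geodesicE a1 a2 a3 b t :
  geodesic a1 a2 a3 b t =
  expmx (f t *: su11 (f a1) (f a3) (f b) + f (a2 * t) *: E)
  * block21 (f (cos (b * t / 2)) + 'i * f (sin (b * t / 2))) 0
              0 (f (cos (b * t / 2)) - 'i * f (sin (b * t / 2))) 1.
Proof.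
rewrite /geodesic -/(line K) velocity_split su11_axis -rmorphM.
have -> : su11 0 0 (f (- (t * b))) = su11 0 0 (f (- (t * b))) + f 0 *: E.
  by rewrite rmorph0 scale0r addr0.
rewrite expmx_rotation expR0 rmorph1 mulNr cosN sinN rmorphN mulrN opprK.
by rewrite [t * b]mulrC.
Qed.

(** With [theta = b t / 2], the first row of the product of the two factors is
    [(n - i b m) e^(i theta)], [m (a1 + i a3) e^(- i theta)]; the angle [phi]
    is defined by [a1 + i a3 = r e^(- i phi)]. *)
Lemma geodesic_su11 a1 a2 a3 b phi t :
  a1 ^+ 2 + a2 ^+ 2 + a3 ^+ 2 = 1 ->
  let m := m2 a2 b t in let n := n2 a2 b t in
  let r := Num.sqrt (1 - a2 ^+ 2) in
  let A := f (n * cos (b * t / 2) + b * m * sin (b * t / 2))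
           + 'i * f (n * sin (b * t / 2) - b * m * cos (b * t / 2)) in
  let B := f (m * r) * (f (cos (b * t / 2 + phi))
                        + 'i * f (- sin (b * t / 2 + phi))) in
  a1 = r * cos phi -> a3 = - (r * sin phi) ->
  `|A| ^+ 2 - `|B| ^+ 2 = 1 /\
  geodesic a1 a2 a3 b t = block21 A B B^* A^* (f (expR (a2 * t))).
Proof.
move=> ha m n r A B a1E a3E; have i2 := sqrCi K.
have r2 : r ^+ 2 = 1 - a2 ^+ 2.
  rewrite sqr_sqrtr// -ha.
  have -> : a1 ^+ 2 + a2 ^+ 2 + a3 ^+ 2 - a2 ^+ 2 = a1 ^+ 2 + a3 ^+ 2 by ring.
  by rewrite addr_ge0 ?sqr_ge0.
have nm : n ^+ 2 + (b ^+ 2 - r ^+ 2) * m ^+ 2 = 1.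
  by rewrite -(m2_n2_norm R a2 b t) r2 -/m -/n; ring.
have Bc : B^* = f (m * r) * (f (cos (b * t / 2 + phi))
                             - 'i * f (- sin (b * t / 2 + phi))).
  by rewrite /B (rmorphM Num.conj) /= f_conj conj_rect.
have Ac : A^* = f (n * cos (b * t / 2) + b * m * sin (b * t / 2))
           - 'i * f (n * sin (b * t / 2) - b * m * cos (b * t / 2)).
  by rewrite /A conj_rect.
split.
  have cs := cos2Dsin2 (b * t / 2); have cs' := cos2Dsin2 (b * t / 2 + phi).
  have -> : 1 = f ((n ^+ 2 + b ^+ 2 * m ^+ 2)
                     * (cos (b * t / 2) ^+ 2 + sin (b * t / 2) ^+ 2)
      - m ^+ 2 * r ^+ 2 * (cos (b * t / 2 + phi) ^+ 2
                           + sin (b * t / 2 + phi) ^+ 2)).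
    rewrite cs cs' [X in f X](_ : _ = 1) ?rmorph1// -[RHS]nm; ring.
  by rewrite !normCK Ac Bc /A /B; ring: i2.
rewrite geodesicE expmx_velocity// exp_su11_block21 block21M Ac Bc /A /B.
rewrite a1E a3E cosD sinD.
by f_equal; ring: i2.
Qed.

(** At the poles both exponents are rotations of opposite angles. *)
Lemma geodesic_pole a2 b t :
  geodesic 0 a2 0 b t = block21 1 0 0 1 (f (expR (a2 * t))).
Proof.
have i2 := sqrCi K.
rewrite geodesicE rmorph0 su11_axisZ -rmorphM expmx_rotation block21M.
rewrite [t * b]mulrC.
have cs : f (cos (b * t / 2)) ^+ 2 = 1 - f (sin (b * t / 2)) ^+ 2.
  by rewrite -rmorphXn cos2sin2 rmorphB rmorph1 rmorphXn.
by f_equal; ring: i2 cs.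
Qed.

End Geodesics.

Local Open Scope complex_scope.

(** * The embedding of the reals in R[i] *)

Section Embedding.
Local Open Scope classical_set_scope.

Lemma cvg_real_complex (R : realType) (u : nat -> R) (l : R) :
  u @ \oo --> l ->
  (fun k => (u k)%:C : (R[i] : numClosedFieldType)) @ \oo
    --> (l%:C : (R[i] : numClosedFieldType)).
Proof.
move=> /cvgrPdist_lt ul; apply/cvgrPdist_lt => -[x y].
(* A positive complex number is a positive real one. *)
rewrite ltcE /= => /andP[/eqP -> x0]; near=> n.
rewrite -rmorphB normc_def /= expr0n addr0 sqrtr_sqr ltcR.
by near: n; exact: ul.
Unshelve. all: by end_near. Qed.

Lemma conj_real_complex (R : realType) (x : R) :
  Num.conj (x%:C : (R[i] : numClosedFieldType)) = x%:C.
Proof. by rewrite conj_Creal//; apply/complex_realP; exists x. Qed.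

Lemma rectE (R : realType) (x y : R) : x +i* y = x%:C + 'i * y%:C :> R[i].
Proof. by rewrite -complexiE; simpc. Qed.

End Embedding.

(** * The geodesic formulas *)

Theorem theorem3 (R : realType) (a1 a2 a3 b : R)
    (ha : a1 ^+ 2 + a2 ^+ 2 + a3 ^+ 2 = 1) :
  (a2 <> 1 /\ a2 <> -1 ->
   forall phi0 : R,
     cos phi0 = a1 / Num.sqrt (1 - a2 ^+ 2) ->
     sin phi0 = - (a3 / Num.sqrt (1 - a2 ^+ 2)) ->
   forall t : R,
     let m := m2 a2 b t in
     let n := n2 a2 b t in
     is_su11R (gamma2 a1 a2 a3 b t)
       ((n * cos (b * t / 2) + b * m * sin (b * t / 2)) +i*
        (n * sin (b * t / 2) - b * m * cos (b * t / 2)))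
       ((m * Num.sqrt (1 - a2 ^+ 2))%:C *
        (cos (b * t / 2 + phi0) -i* sin (b * t / 2 + phi0)))
       (a2 * t))
  /\
  (a2 = 1 \/ a2 = -1 ->
   forall t : R, is_su11R (gamma2 a1 a2 a3 b t) 1 0 (a2 * t)).
Proof.
have s2 : a1 ^+ 2 + a3 ^+ 2 = 1 - a2 ^+ 2 by rewrite -ha; ring.
split=> [[a2N1 a2Nm1] phi0 cphi sphi t m n|a2pole t].
- have r0 : Num.sqrt (1 - a2 ^+ 2) != 0.
    rewrite sqrtr_eq0 -ltNge lt0r -s2 addr_ge0 ?sqr_ge0// andbT s2.
    rewrite subr_eq0 eq_sym sqrf_eq1 negb_or.
    by apply/andP; split; apply/eqP.
  have a1E : a1 = Num.sqrt (1 - a2 ^+ 2) * cos phi0.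
    by rewrite cphi mulrC divfK.
  have a3E : a3 = - (Num.sqrt (1 - a2 ^+ 2) * sin phi0).
    by rewrite sphi mulrN opprK mulrC divfK.
  rewrite !rectE.
  exact: (@geodesic_su11 R R[i] (real_complex R) (@cvg_real_complex R)
    (@conj_real_complex R) a1 a2 a3 b phi0 t ha a1E a3E).
- have /eqP : a1 ^+ 2 + a3 ^+ 2 = 0.
    by rewrite s2; case: a2pole => ->; rewrite ?sqrrN expr1n subrr.
  rewrite paddr_eq0 ?sqr_ge0// !sqrf_eq0 => /andP[/eqP -> /eqP ->].
  split; first by rewrite normr1 normr0 expr1n expr0n subr0.
  transitivity (block21 1 0 0 1 (expR (a2 * t))%:C : 'M[R[i]]_3).
    have := @geodesic_pole R R[i] (real_complex R) (@cvg_real_complex R) a2 b t.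
    by rewrite /geodesic !rmorph0.
  by rewrite /su11R_mx /block21 rmorph0 rmorph1.
Qed.
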